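(* Suppose $\mathcal{A} \subseteq \mathcal{F}$ is such that $(\mathbb{N},\mathcal{A},\nu)$ is a measure space (that is, $\mathcal{A}$ is a $\sigma$-field and $\nu$ is countably additive on $\mathcal{A}$). Then every measurable function $f:\mathbb{N}\to\mathbb{R}$ on $(\mathbb{N},\mathcal{A},\nu)$ is of the form \[ f = \sum_{j = 1}^J a_j I_{A_j} + g, \] where $J$ may be finite or (countably) infinite, $a_j \in \mathbb{R}$ and $A_j \in \mathcal{A}$ with $\nu(A_j) > 0$ for each $j$, the sets $\{ A_j \}_{j=1}^{J}$ are pairwise disjoint, and $g$ is non-zero only on a null set disjoint from $\bigcup_{j=1}^J A_j$.
   Context: $\mathbb{N} = \{1,2,3,\ldots\}$. $\mathcal{F}$ is the collection of all $A \subseteq \mathbb{N}$ for which the limit $\nu(A) := \lim_{N\to\infty} \frac{1}{N}\sum_{n=1}^N I_A(n)$ exists, where $I_A$ is the indicator function of $A$. A null set is an element of $\mathcal{N} := \{A \in \mathcal{F} : \nu(A) = 0\}$. ''Measurable'' is meant in the standard measure-theoretic sense (preimages of Borel sets lie in $\mathcal{A}$). *)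

(* Defs.v *)
From HB Require Import structures.
From mathcomp Require Import all_boot all_order all_algebra.
From mathcomp Require Import all_classical all_reals all_analysis.

Set Implicit Arguments.
Unset Strict Implicit.
Unset Printing Implicit Defensive.

Import Order.TTheory GRing.Theory Num.Theory.
Import numFieldNormedType.Exports.

Local Open Scope classical_set_scope.
Local Open Scope ring_scope.

Definition natp := {n : nat | (0 < n)%N}.

HB.instance Definition _ := Choice.on natp.
HB.instance Definition _ := isPointed.Build natp (exist _ 1%N isT).

Section Density.
Variable R : realType.
Implicit Types A : set natp.

(* The value at N = 0 is the junk value 0, which does not affect the limit. *)
Definition freq A (N : nat) : R :=
  N%:R^-1 * \sum_(1 <= n < N.+1) \1_[set val m | m in A] n.

Definition has_density A : Prop := cvgn (freq A).

Definition density A : R := limn (freq A).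

Definition density_null A : Prop := has_density A /\ density A = 0.

(* For a sigma-field cA, the measurable sets of g_sigma_algebraType cA are
   exactly the elements of cA. No condition is needed for nonnegativity or
   density set0 = 0, which hold by definition of density. *)
Definition density_measure_space (cA : set (set natp)) : Prop :=
  sigma_algebra [set: natp] cA /\
  sigma_additive
    (fun A : set (g_sigma_algebraType cA) => (density A)%:E).

End Density.

(* J ranges over {1, 2, ...} together with None, which stands for infinity. *)
Definition index_range (J : option natp) : set nat :=
  [set j | (1 <= j)%N /\ if J is Some m then (j <= val m)%N else True].

Definition is_sum (R : realType) (J : option natp) (u : nat -> R) (s : R) :
    Prop :=
  if J is Some m then \sum_(1 <= j < (val m).+1) u j = s
  else \sum_(1 <= j < n.+1) u j @[n --> \oo] --> s.

(* Main.v *)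
Require Import Defs.
From HB Require Import structures.
From mathcomp Require Import all_boot all_order all_algebra.
From mathcomp Require Import all_classical all_reals all_analysis.

Set Implicit Arguments.
Unset Strict Implicit.
Unset Printing Implicit Defensive.

Import Order.TTheory GRing.Theory Num.Theory.
Import numFieldNormedType.Exports.

Local Open Scope classical_set_scope.
Local Open Scope ring_scope.

(** The idea: [natp] is countable, so [f] takes countably many values and the
domain splits into countably many fibres [f @^-1` [set c]], all of them
measurable.  The [A_j] are the fibres of positive density and the [a_j] are the
corresponding values, while [g] is [f] restricted to the union [E] of the fibres of
density zero.  Countable additivity makes [E] a null set
([density_bigcup_eq0]).  As every index range contains the index 1, at least one
fibre of positive density is needed; there is one, since otherwise [E] would
be everything, and the whole space has density 1 ([density_setT]).  The set of
values with a fibre of positive density is thus countable and nonempty, and it can be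
listed without repetition along an index range ([index_range_enum]).  At each
point the series has at most one nonzero term ([is_sum_single]), so
convergence is immediate. *)

Lemma density_ge0 (R : realType) (A : set natp) : 0 <= density R A.
Proof.
rewrite /density.
(* The limit of a divergent sequence is the default point of R, which is 0. *)
have [cv|/dvgP ->] := pselect (cvgn (@freq R A)); last by [].
apply: limr_ge => //; apply: nearW => N.
by rewrite /freq mulr_ge0 ?invr_ge0 ?sumr_ge0.
Qed.

Lemma density_set0 (R : realType) : density R set0 = 0.
Proof.
rewrite /density; have -> : @freq R set0 = (fun=> 0); last exact: lim_cst.
apply/funext => N; rewrite /freq image_set0 big1 ?mulr0 // => n _.
by rewrite indic0.
Qed.

Lemma density_setT (R : realType) : density R setT = 1.
Proof.
rewrite /density; apply/cvg_lim => //; apply: cvg_near_cst.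
exists 1%N => // N /= N_gt0.
rewrite /freq (eq_big_nat _ _ (F2 := fun=> 1)); last first.
  move=> n /andP[n_gt0 _]; rewrite indicE mem_set //.
  by exists (exist _ n n_gt0).
by rewrite sumr_const_nat subn1 /= mulVf // pnatr_eq0 -lt0n.
Qed.

(** Nonnegativity and [density_set0] complete the hypothesis to a
measure on the sigma-algebra, whose negligible sets are closed under countable
unions, disjoint or not. *)
Lemma density_bigcup_eq0 (R : realType) (cA : set (set natp))
    (hA : density_measure_space R cA) (F : nat -> set natp) :
  (forall k, cA (F k)) -> (forall k, density R (F k) = 0) ->
  density R (\bigcup_k F k) = 0.
Proof.
case: hA => sA addA cF F0.
pose T := g_sigma_algebraType cA.
have mE : @measurable _ T = cA by exact: sigma_algebra_id.
pose nu : set T -> \bar R := fun A => (density R A)%:E.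
have nu0 : nu set0 = 0%E by rewrite /nu density_set0.
have nu_ge0 A : (0 <= nu A)%E by rewrite lee_fin density_ge0.
have nu_semi : semi_sigma_additive nu by move=> G mG tG _; exact: addA.
pose mu : {measure set T -> \bar R} :=
  HB.pack nu (isMeasure.Build _ T R nu nu0 nu_ge0 nu_semi).
have mF k : measurable (F k : set T) by rewrite mE.
have muF k : mu.-negligible (F k).
  by apply/negligibleP => //; rewrite /mu /= /nu F0.
have /negligibleP : mu.-negligible (\bigcup_k F k) by exact: negligible_bigcup.
move=> /(_ (bigcupT_measurable _ mF)) /=.
by rewrite /nu => -[].
Qed.

(** The finite and infinite cases correspond to the two forms of [J]; [V] must
be nonempty because a finite index range never is empty. *)
Lemma index_range_enum (T : pointedType) (V : set T) :
  countable V -> V !=set0 ->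
  exists (J : option natp) (e : nat -> T), set_bij (index_range J) V e.
Proof.
move=> cV V0; have [/finite_setP[[|n] Vn]|infV] := pselect (finite_set V).
- by move: Vn V0; rewrite II0 card_eq0 => /eqP -> [].
- have /card_set_bijP[e [eV einj esurj]] := card_esym Vn.
  (* Index ranges start at 1, initial segments of nat at 0. *)
  exists (Some (exist _ n.+1 isT)), (fun j => e j.-1); split.
  + by move=> [|j] [//= _ jn]; apply: eV.
  + move=> [|i] [|j] /set_mem[//= _ iJ] /set_mem[//= _ jJ] eij.
    by congr _.+1; apply: einj eij; apply/mem_set.
  + by move=> v /esurj[j jn <-]; exists j.+1.
- have /card_esym/card_set_bijP[e [eV einj esurj]] := eq_card_nat cV infV.
  exists None, (fun j => e j.-1); split.
  + by move=> j _; apply: eV.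
  + move=> [|i] [|j] /set_mem[//= _ _] /set_mem[//= _ _] eij.
    by congr _.+1; apply: einj eij; apply/mem_set.
  + by move=> v /esurj[j _ <-]; exists j.+1.
Qed.

Lemma is_sum0 (R : realType) (J : option natp) (u : nat -> R) :
  (forall j, index_range J j -> u j = 0) -> is_sum J u 0.
Proof.
case: J => [m|] u0 /=.
  rewrite big_nat big1 // => j /andP[j_gt0 jm]; exact: u0.
apply: cvg_near_cst; apply: nearW => n.
by rewrite big_nat big1 // => j /andP[j_gt0 _]; exact: u0.
Qed.

Lemma is_sum_single (R : realType) (J : option natp) (u : nat -> R) (k : nat) :
  index_range J k -> (forall j, index_range J j -> j != k -> u j = 0) ->
  is_sum J u (u k).
Proof.
move=> kJ u0.
have sumE n : (k <= n)%N ->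
    (forall j, (0 < j <= n)%N -> index_range J j) ->
    \sum_(1 <= j < n.+1) u j = u k.
  move=> kn nJ; rewrite (bigD1_seq k) ?iota_uniq //=; last first.
    by rewrite mem_index_iota ltnS kn (proj1 kJ).
  rewrite big_seq_cond big1 ?addr0 // => j; rewrite mem_index_iota.
  move=> /andP[jn jk].
  by apply: u0 => //; apply: nJ.
case: J kJ u0 sumE => [m|] [k_gt0 km] u0 sumE /=.
  by apply: sumE => // j /andP[].
apply: cvg_near_cst; exists k => // n /= kn.
by apply: sumE => // j /andP[].
Qed.

Theorem theorem8p2 (R : realType) (cA : set (set natp))
    (hF : cA `<=` @has_density R)
    (hA : density_measure_space R cA)
    (f : g_sigma_algebraType cA -> R)
    (mf : measurable_fun [set: g_sigma_algebraType cA] f) :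
  exists (J : option natp) (a : nat -> R) (A : nat -> set natp)
      (g : natp -> R),
    [/\ forall j, index_range J j -> cA (A j) /\ 0 < density R (A j),
        trivIset (index_range J) A,
        exists E : set natp,
          [/\ density_null R E,
              E `&` \bigcup_(j in index_range J) A j = set0 &
              [set x | g x != 0] `<=` E] &
        forall x : natp, is_sum J (fun j => a j * \1_(A j) x) (f x - g x)].
Proof.
have [sA _] := hA.
have mfib c : cA (f @^-1` [set c]).
  rewrite -(sigma_algebra_id sA) -[X in _ X]setTI.
  exact: mf (measurable_set1 c).
pose V := [set c | 0 < density R (f @^-1` [set c])].
pose E : set natp := [set x | ~ V (f x)].
pose pt n : natp := exist _ n.+1 isT.
have ptK (x : natp) : pt (val x).-1 = x.
  by apply/val_inj; rewrite /= prednK // (valP x).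
(* The same fibre recurs for every point of it, so the F n are not disjoint. *)
pose F n : set natp := if pselect (V (f (pt n))) then set0
                       else f @^-1` [set f (pt n)].
have EF : E = \bigcup_n F n.
  apply/seteqP; split=> [x Ex|x [n _]].
    by exists (val x).-1 => //; rewrite /F ptK; case: pselect.
  by rewrite /F; case: pselect => // nV /= fx; rewrite /E /= fx.
have cF n : cA (F n).
  by rewrite /F; case: pselect => //= ?; case: sA.
have E0 : density R E = 0.
  rewrite EF; apply: (density_bigcup_eq0 hA) => // n.
  rewrite /F; case: pselect => [?|/= /negP]; first exact: density_set0.
  by rewrite -leNgt => le0; apply/le_anti; rewrite le0 density_ge0.
have cE : cA E by rewrite EF; case: sA => _ _; apply.
have V0 : V !=set0.
  apply: contrapT => /set0P/negP/negPn/eqP V_eq0.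
  have : density R E = 1.
    rewrite -(density_setT R); congr density; apply/seteqP; split=> // x _.
    by rewrite /E /= V_eq0.
  by rewrite E0 => /esym/eqP; rewrite oner_eq0.
have cV : countable V.
  have Vsub : V `<=` range (f \o pt).
    move=> c Vc; apply: contrapT => nc.
    suff fib0 : f @^-1` [set c] = set0.
      by move: Vc; rewrite /V /= fib0 density_set0 ltxx.
    rewrite -subset0 => x /= fx; apply: nc; exists (val x).-1 => //=.
    by rewrite ptK.
  apply: sub_countable (subset_card_le Vsub) _.
  exact: card_le_trans (card_image_le _ _) (countableP _).
have [J [e [eV einj esurj]]] := index_range_enum cV V0.
exists J, e, (fun j => f @^-1` [set e j]),
  (fun x => if pselect (V (f x)) then 0 else f x); split.
- by move=> j /eV Vj; split; [exact: mfib|exact: Vj].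
- move=> i j iJ jJ [x [/= fi fj]].
  by apply: einj; rewrite ?inE // -fi -fj.
- exists E; split; first by split=> //; exact: hF.
    rewrite -subset0 => x [Ex [j jJ /= fx]].
    by apply: Ex; rewrite fx; exact: eV.
  by move=> x /=; case: pselect => // ?; rewrite eqxx.
- move=> x; have [Vx|nVx] := pselect (V (f x)).
    have [k kJ fx] := esurj _ Vx.
    case: pselect => // ?.
    have := @is_sum_single R J (fun j => e j * \1_(f @^-1` [set e j]) x) k kJ.
    rewrite subr0 indicE mem_set //= mulr1 fx; apply => j jJ jk.
    rewrite indicE memNset ?mulr0 //= -fx => ejk.
    by move/eqP: jk; apply; apply: einj; rewrite ?inE.
  case: pselect => // ?; rewrite subrr; apply: is_sum0 => j jJ.
  rewrite indicE memNset ?mulr0 //= => fx.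
  by apply: nVx; rewrite fx; exact: eV.
Qed.
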